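(* Let $\mathcal I\subset\Pi$ have chain form $T_{\mathcal I}=(C_1,C_2,\dots,C_l)$ ($l\ge2$), and set $c_i=|C_i|$. Assume $c_1=c_l=:c$ and $c_j\neq c$ for all $j$ with $1<j<l$. Then the polynomial $m_{l_{\mathcal I}}$ is irreducible.
   Context: Ground field $\mathbb C$; $e_{i,j}$ are the $n\times n$ matrix units and $\Pi=\{\alpha_1,\dots,\alpha_{n-1}\}$ the simple roots of $\mathfrak{gl}_n$ ($\alpha_i$ is the root of $e_{i,i+1}$). Given $\mathcal I\subset\Pi$, partition $\{1,\dots,n\}$ into maximal intervals $C_1,\dots,C_l$ (chains, in increasing order) such that $i,i+1$ lie in the same interval iff $\alpha_i\in\mathcal I$ (this is what ''chain form $T_{\mathcal I}=(C_1,\dots,C_l)$'' records). $\mathfrak m_{\mathcal I}=\mathrm{span}\{e_{a,b}: a\in C_i,\ b\in C_j,\ i<j\}$. Let $x_{a,b}$, for $e_{b,a}\in\mathfrak m_{\mathcal I}$, be independent variables (coordinate functions on $\mathfrak m_{\mathcal I}$), generating the polynomial ring $S(\mathfrak m_{\mathcal I}^-)$. Let $\mathcal M_{\mathcal I}$ be the $n\times n$ matrix with $(a,b)$ entry $x_{a,b}$ if $e_{b,a}\in\mathfrak m_{\mathcal I}$ and $0$ otherwise. When $l\ge 2$ and $c_1=c_l=c$, let $M^c_{\mathcal I}(t)$ be the $(n-c)\times(n-c)$ minor of $\mathcal M_{\mathcal I}+t\,\mathrm{Id}$ with rows $c+1,\dots,n$ and columns $1,\dots,n-c$, $t$ an indeterminate.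 Put $d_{\mathcal I}=\sum_{i=1}^l\max(c_i-c,0)$, $l_{\mathcal I}=n-c-d_{\mathcal I}$. Then $m_{l_{\mathcal I}}\in S(\mathfrak m_{\mathcal I}^-)$ is the coefficient of $t^{d_{\mathcal I}}$ in $M^c_{\mathcal I}(t)$ (it is the lowest non-zero coefficient). *)

(* Defs.v *)
From HB Require Import structures.
From mathcomp Require Import all_boot all_order all_algebra.
From mathcomp Require Export complex mpoly reals.

Set Implicit Arguments.
Unset Strict Implicit.
Unset Printing Implicit Defensive.

Import GRing.Theory.
Local Open Scope ring_scope.

(* All indices are shifted by one with respect to the usual convention: the
   set {1, ..., n} is 'I_n = {0, ..., n-1}, the simple root alpha_(k+1) (the
   root of the matrix unit e_{k+1,k+2}) is k : 'I_n.-1, and the chains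
   C_1, ..., C_l are the entries nth set0 C 0, ..., nth set0 C l.-1 of a
   sequence C of size l. *)

Definition chain_form (n : nat) (I : {set 'I_n.-1}) (C : seq {set 'I_n}) : Prop :=
  [/\ uniq C,
      partition [set:: C] [set: 'I_n],
      forall (i j : nat) (a b : 'I_n), (i < j < size C)%N ->
        a \in nth set0 C i -> b \in nth set0 C j -> (a < b)%N
    & forall (k : 'I_n.-1) (a b : 'I_n), a = k :> nat -> b = k.+1 :> nat ->
        (exists2 B, B \in C & (a \in B) && (b \in B)) <-> k \in I].

Lemma chain_form_exists (n : nat) (I : {set 'I_n.-1}) :
  exists C : seq {set 'I_n}, chain_form I C.
Proof.
pose h (m : nat) := #|[set k : 'I_n.-1 | (k < m)%N && (k \notin I)]|.
have hS (k : 'I_n.-1) : h k.+1 = ((k \notin I) + h k)%N.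
  rewrite /h (cardsD1 k) inE ltnSn /=; congr (_ + _)%N.
  apply: eq_card => j; rewrite !inE ltnS andbA leq_eqVlt -val_eqE /=.
  by case: (ltngtP j k).
have h_mono : {homo h : m p / (m <= p)%N}.
  move=> m p le_mp; apply: subset_leq_card; apply/subsetP => k.
  by rewrite !inE => /andP[lt_km ->]; rewrite (leq_trans lt_km le_mp).
have h0 : h 0%N = 0%N by apply: eq_card0 => k; rewrite inE ltn0.
have h_onto m i : (m < n)%N -> (i <= h m)%N -> exists2 a : 'I_n, (a <= m)%N & h a = i.
  elim: m i => [|m IHm] i ltmn.
    by rewrite h0 leqn0 => /eqP->; exists (Ordinal ltmn).
  have lt_m : (m < n.-1)%N by case: n ltmn {I h hS h_mono h0 IHm}.
  have [le_i _|lt_i] := leqP i (h m).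
    by have [a /leqW le_am ha] := IHm i (ltnW ltmn) le_i; exists a.
  move=> le_i; exists (Ordinal ltmn) => //=; apply/eqP.
  rewrite eqn_leq le_i andbT (leq_trans _ lt_i) //.
  by rewrite -[m]/(val (Ordinal lt_m)) hS; case: (_ \in I).
pose blk i := [set a : 'I_n | h a == i].
pose l := (\max_(a < n) (h a).+1)%N.
have blkN i : (i < l)%N -> exists a : 'I_n, a \in blk i.
  move=> lt_il; have [a lt_i] : exists a : 'I_n, (i < (h a).+1)%N.
    apply/existsP; apply: contraTT lt_il => /existsPn nlt.
    by rewrite -leqNgt; apply/bigmax_leqP => a _; rewrite leqNgt nlt.
  have [b _ hb] := h_onto a i (ltn_ord a) lt_i.
  by exists b; rewrite inE hb.
have lt_hl (a : 'I_n) : (h a < l)%N by apply: (leq_bigmax (F := fun a : 'I_n => (h a).+1)).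
have nthC i : (i < l)%N -> nth set0 (mkseq blk l) i = blk i by apply: nth_mkseq.
have memC B : reflect (exists2 i, (i < l)%N & B = blk i) (B \in mkseq blk l).
  apply: (iffP mapP) => -[k]; first by rewrite mem_iota; exists k.
  by exists k; rewrite ?mem_iota.
exists (mkseq blk l); split.
- rewrite map_inj_in_uniq ?iota_uniq // => i j; rewrite !mem_iota /= add0n => lti _ eq_ij.
  have [a ai] := blkN i lti; move: (ai); rewrite eq_ij.
  by move: ai; rewrite !inE => /eqP-> /eqP.
- apply/and3P; split.
  + rewrite eqEsubset subsetT; apply/subsetP => a _; apply/bigcupP.
    by exists (blk (h a)); rewrite !inE //; apply/memC; exists (h a).
  + apply/trivIsetP => A B; rewrite !inE => /memC[i _ ->] /memC[j _ ->] nij.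
    rewrite -setI_eq0; apply/eqP/setP => a; rewrite !inE; apply/andP => -[/eqP ai /eqP aj].
    by case/eqP: nij; rewrite -ai -aj.
  + rewrite inE; apply/memC => -[i /blkN[a ai] E].
    by move: ai; rewrite -E inE.
- move=> i j a b; rewrite size_mkseq => /andP[lt_ij lt_jl].
  rewrite !nthC ?(ltn_trans lt_ij) // !inE => /eqP ha /eqP hb.
  by rewrite ltnNge; apply: contraL lt_ij => /h_mono; rewrite ha hb -leqNgt.
- move=> k a b ak bk; have hab : h b = ((k \notin I) + h a)%N by rewrite ak bk hS.
  split=> [[B /memC[i _ ->]]|kI].
    rewrite !inE hab => /andP[/eqP -> ]; case: (k \in I) => //=.
    by rewrite add1n gtn_eqF.
  exists (blk (h a)); first by apply/memC; exists (h a).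
  by rewrite !inE hab kI !eqxx.
Qed.

Definition chain_size (n : nat) (C : seq {set 'I_n}) (i : nat) : nat :=
  #|nth set0 C i|.

Definition chain_lt (n : nat) (C : seq {set 'I_n}) (a b : 'I_n) : bool :=
  [exists i : 'I_(size C), exists j : 'I_(size C),
     [&& (i < j)%N, a \in nth set0 C i & b \in nth set0 C j]].

Definition nilradical (F : fieldType) (n : nat) (C : seq {set 'I_n}) :
    {vspace 'M[F]_n} :=
  (\sum_(p : 'I_n * 'I_n | chain_lt C p.1 p.2) <[delta_mx p.1 p.2]>)%VS.

Lemma mem_nilradical (F : fieldType) (n : nat) (C : seq {set 'I_n}) (a b : 'I_n) :
  (delta_mx a b \in nilradical F C) = chain_lt C a b.
Proof.
apply/idP/idP => [|ltab]; last first.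
  by apply: subvP (memv_line _); apply: (sumv_sup (a, b)) => //=.
case/memv_sumP => v vP Ev; apply: contraT => nlt.
have /eqP := congr1 (fun M : 'M[F]_n => M a b) Ev.
rewrite mxE !eqxx summxE big1 ?oner_eq0 // => -[i j] /= ltij.
have /vlineP[k ->] := vP (i, j) ltij; rewrite !mxE /=.
case: eqP => [ai|]; last by rewrite mulr0.
case: eqP => [bj|]; last by rewrite mulr0.
by move: nlt; rewrite ai bj ltij.
Qed.

(* The index type of the variables x_{a,b}: note the transposition. *)
Definition mvar (F : fieldType) (n : nat) (C : seq {set 'I_n}) :=
  {p : 'I_n * 'I_n | delta_mx p.2 p.1 \in nilradical F C}.

Notation Sm F C := {mpoly F[#|{: mvar F C}|]}.

(* insub (a, b) is Some v exactly when e_{b,a} lies in the nilradical. *)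
Definition Mmx (F : fieldType) (n : nat) (C : seq {set 'I_n}) :
    'M[Sm F C]_n :=
  \matrix_(a, b)
    if insub (a, b) is Some v then 'X_(enum_rank (v : mvar F C)) else 0.

Lemma minor_row_proof (n c : nat) (i : 'I_(n - c)) : (c + i < n)%N.
Proof. by rewrite -ltn_subRL. Qed.

Definition minor_row (n c : nat) (i : 'I_(n - c)) : 'I_n :=
  Ordinal (minor_row_proof i).

Definition minor_col (n c : nat) (j : 'I_(n - c)) : 'I_n :=
  widen_ord (leq_subr c n) j.

(* The indeterminate t is the variable 'X of {poly Sm F C}. *)
Definition Mminor (F : fieldType) (n : nat) (C : seq {set 'I_n}) (c : nat) :
    {poly Sm F C} :=
  \det (mxsub (@minor_row n c) (@minor_col n c)
          (map_mx polyC (Mmx F C) + 'X%:M)).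

(* Subtraction in nat is truncated, so this sums the max(c_i - c, 0). *)
Definition dI (n : nat) (C : seq {set 'I_n}) (c : nat) : nat :=
  (\sum_(i < size C) (chain_size C i - c))%N.

Definition m_lI (F : fieldType) (n : nat) (C : seq {set 'I_n}) (c : nat) :
    Sm F C :=
  (Mminor F C c)`_(dI C c).

Definition irreducible (A : idomainType) (p : A) : Prop :=
  [/\ p != 0, p \isn't a GRing.unit
    & forall q r : A, p = q * r -> q \is a GRing.unit \/ r \is a GRing.unit].

(* Main.v *)
(* Expanding the determinant, the monomials of m correspond bijectively to the
   permutations sending each row either to the diagonal (a factor t) or to a
   column of a strictly earlier chain, with exactly d_I diagonal rows: these are
   systems of c vertex-disjoint paths from C_1 to C_l.  Hence every variable
   x_{a,b} occurs to degree at most 1, and so do the sums of degrees over a fixed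
   row a ("in-degree" of a) and over a fixed column b ("out-degree" of b).  If
   m = g q, each row and each column thus belongs to exactly one of g and q, row a
   and column b to the same one whenever x_{a,b} occurs in m.  The variable x_{a,b}
   occurs as soon as all chains strictly between those of b and a have size < c.
   For a chain of size > c, some monomial avoids some vertex a of it; as m is
   homogeneous for (in-degree - out-degree) of a, the row and the column of a belong
   to the same factor.  Since no middle chain has size c, this connects all the
   rows, so one of the factors is constant. *)
Require Import Defs.
From HB Require Import structures.
From mathcomp Require Import all_boot all_order all_algebra.
From mathcomp Require Import perm zify.
From mathcomp Require Import complex mpoly reals.

Set Implicit Arguments.
Unset Strict Implicit.
Unset Printing Implicit Defensive.

Import GRing.Theory.
Local Open Scope ring_scope.

(** * Weighted degrees of multivariate polynomials *)

Lemma pred_size_mul (R : idomainType) (p q : {poly R}) : p != 0 -> q != 0 ->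
  (size (p * q)%R).-1 = ((size p).-1 + (size q).-1)%N.
Proof.
move=> p0 q0; rewrite size_mul //; move: p0 q0; rewrite -!size_poly_gt0.
by case: (size p) (size q) => [|a] [|b] // _ _; rewrite addSn addnS.
Qed.

Section WeightedDegree.

Variables (N : nat) (F : idomainType).
Implicit Types (w : 'I_N -> nat) (m : 'X_{1..N}) (p q : {mpoly F[N]}).

Definition wt w m : nat := (\sum_(i < N) w i * m i)%N.

(** Replaces X_i by X_i T^(w i), so the coefficient of T^k is the part of [p] of weight [k].
    Weighted degree becomes degree in T over a domain, hence is additive on nonzero products. *)
Definition wscale w p : {poly {mpoly F[N]}} :=
  mmap (polyC \o @mpolyC N F) (fun i => ('X_i)%:P * 'X^(w i)) p.

Definition wdeg w p : nat := (size (wscale w p)).-1.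

Lemma wscaleM w p q : wscale w (p * q) = wscale w p * wscale w q.
Proof. exact: rmorphM. Qed.

Lemma wscaleX w m : wscale w 'X_[m] = ('X_[m])%:P * 'X^(wt w m).
Proof.
rewrite /wscale mmapX /mmap1 mpolyXE_id rmorph_prod /= /wt -prodrXr -big_split /=.
by apply: eq_bigr => i _; rewrite exprMn -exprM rmorphXn.
Qed.

Lemma coef_wscale w p k m : ((wscale w p)`_k)@_m = p@_m *+ (wt w m == k).
Proof.
rewrite [p in wscale w p]mpolyE /wscale raddf_sum coef_sum raddf_sum /=.
under eq_bigr => m' _.
  rewrite mmapZ -/(wscale w _) wscaleX /= mulrA -polyCM coefCM coefXn mul_mpolyC.
  rewrite mulr_natr mcoeffMn mcoeffZ mcoeffX.
over.
rewrite /=.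
have [pm|pm] := boolP (m \in msupp p).
  rewrite (bigD1_seq m) //= ?msupp_uniq // eqxx mulr1 big1 ?addr0 => [|m' /negPf->].
    by rewrite eq_sym.
  by rewrite mulr0 mul0rn.
rewrite big_seq big1; first by move: pm; rewrite mcoeff_msupp negbK => /eqP->; rewrite mul0rn.
by move=> m' pm'; case: eqP pm' => [->|_ _]; rewrite ?(negPf pm) ?mulr0 ?mul0rn.
Qed.

Lemma wscale_neq0 w p : p != 0 -> wscale w p != 0.
Proof.
move=> /mlead_supp; set m := mlead p => pm.
apply: contraTneq pm => p0; rewrite mcoeff_msupp negbK.
by have := coef_wscale w p (wt w m) m; rewrite p0 coef0 mcoeff0 eqxx => ->.
Qed.

Lemma wdegM w p q : p * q != 0 -> wdeg w (p * q) = (wdeg w p + wdeg w q)%N.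
Proof.
rewrite mulf_eq0 negb_or /wdeg wscaleM => /andP[p0 q0].
exact: pred_size_mul (wscale_neq0 w p0) (wscale_neq0 w q0).
Qed.

Lemma wt_le_wdeg w p m : m \in msupp p -> (wt w m <= wdeg w p)%N.
Proof.
rewrite mcoeff_msupp => pm; have := coef_wscale w p (wt w m) m; rewrite eqxx => E.
suff: (wt w m < size (wscale w p))%N by rewrite /wdeg; case: size.
by rewrite ltnNge; apply: contra pm => /(nth_default 0) z; rewrite -[p@_m]E z mcoeff0.
Qed.

Lemma wdeg_attained w p : p != 0 -> exists2 m, m \in msupp p & wt w m = wdeg w p.
Proof.
move=> /(wscale_neq0 w); rewrite -lead_coef_eq0 lead_coefE -/(wdeg w p) => nz.
have /mlead_supp := nz; set m := mlead _; rewrite mcoeff_msupp coef_wscale.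
by case: (wt w m =P _) => [wm pm|_]; [exists m; rewrite ?mcoeff_msupp|rewrite eqxx].
Qed.

Lemma wdeg_le w k p : (forall m, m \in msupp p -> (wt w m <= k)%N) -> (wdeg w p <= k)%N.
Proof.
move=> le; have [->|/(wdeg_attained w)[m pm <-]] := eqVneq p 0; last exact: le.
by rewrite /wdeg /wscale raddf0 size_poly0.
Qed.

Lemma wdeg_mono w1 w2 p :
  (forall k, w1 k <= w2 k)%N -> (wdeg w1 p <= wdeg w2 p)%N.
Proof.
move=> le12; apply: wdeg_le => m pm; apply: leq_trans (wt_le_wdeg w2 pm).
by apply: leq_sum => k _; rewrite leq_mul2r le12 orbT.
Qed.

Lemma wdeg1 w : wdeg w 1 = 0%N.
Proof.
apply/eqP; rewrite -leqn0; apply: wdeg_le => m; rewrite msupp1 inE => /eqP->.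
by rewrite /wt big1 // => k _; rewrite mnm0E muln0.
Qed.

Lemma wscale_wdeg0 w p : wdeg w p = 0%N -> wscale w p = p%:P.
Proof.
move=> p0; apply/polyP => k; apply/mpolyP => m; rewrite coef_wscale coefC.
have [pm|] := boolP (m \in msupp p).
  have := wt_le_wdeg w pm; rewrite p0 leqn0 => /eqP ->.
  by rewrite eq_sym; case: eqP; rewrite ?mcoeff0.
by rewrite mcoeff_msupp negbK => /eqP z; case: (k == _)%N; rewrite z mul0rn ?mcoeff0.
Qed.

(* The hypothesis says that [g * h] is homogeneous of degree 0 for the grading
   [w1 - w2]; comparing constant terms in the scaling variable then bounds [g]. *)
Lemma wdeg_factor w1 w2 g h m0 :
    (forall m, m \in msupp (g * h) -> wt w1 m = wt w2 m) ->
    m0 \in msupp (g * h) -> wt w1 m0 = 0%N ->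
  wdeg w2 g = 0%N -> wdeg w1 g = 0%N.
Proof.
move=> bal gm0 w0 g0.
have : (wscale w1 (g * h))`_0 = (wscale w2 (g * h))`_0.
  apply/mpolyP => m; rewrite !coef_wscale.
  have [/bal->//|] := boolP (m \in msupp (g * h)).
  by rewrite mcoeff_msupp negbK => /eqP->; rewrite !mul0rn.
(* Since [wscale w2 g] is constant in the scaling variable, [g] divides [c1], whose monomials all
   have [w1]-weight 0. *)
rewrite [in X in _ = X]wscaleM (wscale_wdeg0 g0) coefCM; set c1 := _`_0.
have nz : c1 != 0.
  have := coef_wscale w1 (g * h) 0 m0; rewrite w0 eqxx => E.
  by apply: contraTneq gm0 => z; rewrite mcoeff_msupp negbK -[_@__]E -/c1 z mcoeff0.
move=> E; have: wdeg w1 c1 = 0%N.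
  apply/eqP; rewrite -leqn0; apply: wdeg_le => m.
  by rewrite mcoeff_msupp coef_wscale; case: (wt w1 m =P _) => [->|_]; rewrite ?eqxx.
move: nz; rewrite E => nz; rewrite (wdegM _ nz) => /eqP.
by rewrite addn_eq0 => /andP[/eqP].
Qed.

End WeightedDegree.

(** * Expansion of the minor *)

Section MinorExpansion.

Variables (F : fieldType) (n : nat) (C : seq {set 'I_n}) (c : nat).
Hypothesis chain_lt_irr : forall a, chain_lt C a a = false.
Implicit Types (s : 'S_(n - c)) (om : 'I_n -> 'I_n -> nat).

Local Notation V := (mvar F C).
Local Notation row := (@minor_row n c).
Local Notation col := (@minor_col n c).

(** These are the permutations without a zero factor in the Leibniz formula. The diagonal meant is
    that of the full matrix, where t stands, not that of the minor. *)
Definition admissible s :=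
  [forall i, (col (s i) == row i) || chain_lt C (col (s i)) (row i)].

Definition fixcount s : nat := #|[pred i | col (s i) == row i]|.

Definition edge_mon (a b : 'I_n) : 'X_{1..#|{: V}|} :=
  if insub (a, b) is Some v then U_(enum_rank (v : V))%MM else 0%MM.

Definition perm_mon s : 'X_{1..#|{: V}|} :=
  (\sum_(i | col (s i) != row i) edge_mon (row i) (col (s i)))%MM.

Definition edge_weight om (k : 'I_#|{: V}|) : nat :=
  om (val (enum_val k : V)).1 (val (enum_val k : V)).2.

Lemma wt_edge_mon om a b : chain_lt C b a -> wt (edge_weight om) (edge_mon a b) = om a b.
Proof.
move=> lt_ba; rewrite /edge_mon; case: insubP => [v _ Ev|]; last first.
  by rewrite mem_nilradical lt_ba.
rewrite /wt (bigD1 (enum_rank v)) //= big1 => [|k /negPf nk].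
  by rewrite mnm1E eqxx /edge_weight enum_rankK Ev muln1 addn0.
by rewrite mnm1E eq_sym nk muln0.
Qed.

Lemma wt_perm_mon om s : admissible s ->
  wt (edge_weight om) (perm_mon s) =
  (\sum_(i | col (s i) != row i) om (row i) (col (s i)))%N.
Proof.
move=> /forallP adm; rewrite /wt /perm_mon.
transitivity (\sum_(k < #|{: V}|) \sum_(i | col (s i) != row i)
    edge_weight om k * edge_mon (row i) (col (s i)) k)%N.
  by apply: eq_bigr => k _; rewrite mnm_sumE big_distrr.
rewrite exchange_big /=; apply: eq_bigr => i ni.
by rewrite -[LHS]/(wt _ _) wt_edge_mon //; have := adm i; rewrite (negPf ni).
Qed.

(** The variables of the monomial give back the off-diagonal rows with their images; every other row
    must go to its own diagonal entry. *)
Lemma perm_mon_inj : {in admissible &, injective perm_mon}.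
Proof.
have agree s t i : admissible s -> admissible t -> perm_mon s = perm_mon t ->
    col (s i) != row i -> s i = t i.
  (* The weight [om] isolates one variable, that of row [i] under [s]; it occurs in the monomial of
     [s], hence in that of [t]. *)
  move=> As At E ni; pose om a b : nat := (a == row i) && (b == col (s i)).
  have := congr1 (wt (edge_weight om)) E; rewrite !wt_perm_mon //.
  rewrite (bigD1 i) //= {1}/om !eqxx /= add1n => E1.
  have /existsP[j] : [exists j, (col (t j) != row j) && (om (row j) (col (t j)) != 0%N)].
    apply: contra_eqT E1 => /existsPn z; rewrite [X in _ != X]big1 // => j nj.
    by have := z j; rewrite nj negbK => /eqP.
  case/andP=> _; rewrite /om eqb0 negbK => /andP[/eqP[/addnI/val_inj->] /eqP[]].
  by move/val_inj.
move=> s t As At E; apply/permP => i.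
have [fs|ns] := eqVneq (col (s i)) (row i); last exact: agree.
have [ft|nt] := eqVneq (col (t i)) (row i); last by rewrite (agree t s).
by apply: val_inj; move: fs; rewrite -ft => /(congr1 val).
Qed.

Lemma minor_entry i j :
  mxsub row col (map_mx polyC (Mmx F C) + 'X%:M) i j =
  if (col j == row i) || chain_lt C (col j) (row i) then
    ('X_[if col j != row i then edge_mon (row i) (col j) else 0%MM])%:P
      * 'X^(col j == row i)
  else 0.
Proof.
rewrite !mxE [col j == _]eq_sym /edge_mon; case: insubP => [v|] /=; rewrite mem_nilradical.
  move=> lt_ji Ev; rewrite lt_ji orbT; have -> : (row i == col j) = false.
    by apply: contraTF lt_ji => /eqP->; rewrite chain_lt_irr.
  by rewrite mulr0n addr0 expr0 mulr1.
move=> /negPf->; rewrite orbF polyC0 add0r.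
by case: eqP => // _; rewrite mpolyX0 mul1r expr1 mulr1n.
Qed.

Lemma m_lI_expansion :
  m_lI F C c = \sum_(s | admissible s && (fixcount s == dI C c))
                 (-1) ^+ s *: 'X_[perm_mon s].
Proof.
rewrite /m_lI /Mminor /determinant coef_sum (bigID admissible) /= addrC big1 ?add0r.
  rewrite big_mkcondr /=; apply: eq_bigr => s As.
  have -> : \prod_i mxsub row col (map_mx polyC (Mmx F C) + 'X%:M) i (s i) =
            ('X_[perm_mon s])%:P * 'X^(fixcount s).
    under eq_bigr => i _ do rewrite minor_entry (forallP As i).
    rewrite big_split /=; congr (_ * _).
      by rewrite -rmorph_prod /= /perm_mon [in RHS]big_mkcond /=
                 (big_morph (fun m => 'X_[m]) (@mpolyXD _ _) (@mpolyX0 _ _)).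
    rewrite prodrXr /fixcount -(sum1_card [pred i | col (s i) == row i]); congr (_ ^+ _).
    rewrite [RHS]big_mkcond /=.
    by apply: eq_bigr => i _; rewrite inE; case: (_ == _).
  rewrite mulr_sign (scaler_sign (odd_perm s)) [_ == dI C c]eq_sym.
  by case: (odd_perm s); rewrite ?coefN coefCM coefXn; case: eqP => _;
    rewrite ?mulr1 ?mulr0 ?oppr0.
move=> s; rewrite negb_forall => /existsP[i ni].
by rewrite (bigD1 i) //= minor_entry (negPf ni) mul0r mulr0 coef0.
Qed.

Lemma msupp_m_lI m : m \in msupp (m_lI F C c) ->
  exists2 s, admissible s & m = perm_mon s.
Proof.
rewrite m_lI_expansion mcoeff_msupp raddf_sum /= => nz.
have [s /andP[/andP[As _] /eqP]|] :=
    pickP (fun s => admissible s && (fixcount s == dI C c) && (perm_mon s == m)).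
  by exists s.
move=> none; rewrite big1 ?eqxx // in nz => s Ps.
by have := none s; rewrite Ps /= mcoeffZ mcoeffX => ->; rewrite mulr0.
Qed.

(** Nothing cancels: by [perm_mon_inj] the monomial comes from a single permutation, so its
    coefficient is a sign. *)
Lemma perm_mon_msupp s : admissible s -> fixcount s = dI C c ->
  perm_mon s \in msupp (m_lI F C c).
Proof.
move=> As fs; rewrite m_lI_expansion mcoeff_msupp raddf_sum /=.
rewrite (bigD1 s) ?As ?fs ?eqxx //= big1 => [|t /andP[/andP[At _] nts]].
  by rewrite addr0 mcoeffZ mcoeffX eqxx mulr1 signr_eq0.
rewrite mcoeffZ mcoeffX; case: eqP => [E|_]; last by rewrite mulr0.
by rewrite (perm_mon_inj At As E) eqxx in nts.
Qed.

End MinorExpansion.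

(** * Connecting rows and columns *)

Lemma sum_eq_inj (T : finType) (U : eqType) (f : T -> U) (P : pred T) (x : T) :
  injective f -> (\sum_(i | P i) (f i == f x) = P x)%N.
Proof.
move=> injf; rewrite big_mkcond (bigD1 x) //= big1 ?addn0 ?eqxx; first by case: (P x).
by move=> i /negPf ni; rewrite inj_eq // ni if_same.
Qed.

Lemma sum_eq_inj_le1 (T : finType) (U : eqType) (f : T -> U) (P : pred T) (y : U) :
  injective f -> (\sum_(i | P i) (f i == y) <= 1)%N.
Proof.
move=> injf; have [x /eqP <-|none] := pickP (fun x => f x == y).
  by rewrite sum_eq_inj //; case: (P x).
by rewrite big1 // => i _; rewrite none.
Qed.

Lemma minor_row_inj n c : injective (@minor_row n c).
Proof. by move=> i j /(congr1 val) /addnI /val_inj. Qed.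

Lemma minor_col_inj n c : injective (@minor_col n c).
Proof. by move=> i j /(congr1 val) E; apply: val_inj. Qed.

Lemma minor_row_surj n c (a : 'I_n) : (c <= a)%N -> exists i, @minor_row n c i = a.
Proof.
move=> le_ca; have lt : (a - c < n - c)%N by rewrite ltn_sub2r // (leq_ltn_trans le_ca).
by exists (Ordinal lt); apply: val_inj; rewrite /= subnKC.
Qed.

Lemma minor_col_surj n c (b : 'I_n) : (b < n - c)%N -> exists j, @minor_col n c j = b.
Proof. by move=> lt; exists (Ordinal lt); apply: val_inj. Qed.

Lemma mpoly_const_unit (N : nat) (F : fieldType) (p : {mpoly F[N]}) :
  p != 0 -> (forall m, m \in msupp p -> m = 0%MM) -> p \is a GRing.unit.
Proof.
move=> p0 const; have Ep : p = (p@_0)%:MP.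
  apply/mpolyP => m; rewrite mcoeffC eq_sym.
  have [->|m0] := eqVneq m 0%MM; first by rewrite mulr1.
  by rewrite mulr0; apply/eqP; rewrite mcoeff_eq0; apply: contra m0 => /const->.
have c0 : p@_0 != 0 by apply: contraNneq p0 => c0; rewrite Ep c0 mpolyC0.
apply/unitrP; exists (p@_0)^-1%:MP.
by rewrite {2 3}Ep -!mpolyCM mulVf // mulfV // mpolyC1.
Qed.

Section Connectivity.

Variables (F : fieldType) (n : nat) (C : seq {set 'I_n}) (c l : nat) (h : 'I_n -> nat).
Hypothesis chain_ltE : forall a b, chain_lt C a b = (h a < h b)%N.
Hypothesis l_gt1 : (1 < l)%N.
Hypothesis rowE : forall a, (0 < h a)%N = (c <= a)%N.
Hypothesis colE : forall a, (h a < l.-1)%N = (a < n - c)%N.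

Local Notation V := (mvar F C).
Local Notation row := (@minor_row n c).
Local Notation col := (@minor_col n c).
Local Notation csize k := (#|[set v | h v == k]|).

Hypothesis csize_first : csize 0%N = c.
Hypothesis csize_last : csize l.-1 = c.
Hypothesis csize_gt0 : forall k, (k < l)%N -> (0 < csize k)%N.
Hypothesis h_lt : forall v, (h v < l)%N.
Hypothesis csize_mid : forall k, (0 < k < l.-1)%N -> csize k <> c.

(** This and [vertex_avoided] are the two combinatorial inputs; they are supplied below by
    [edge_perm] and [avoiding_perm]. *)
Hypothesis edge_occurs : forall a b, (h b < h a)%N ->
  (forall k, (h b < k < h a)%N -> (csize k < c)%N) ->
  exists2 s : {perm 'I_(n - c)}, admissible C s /\ fixcount s = dI C c &
    exists i, row i = a /\ col (s i) = b.

Hypothesis vertex_avoided : forall k, (c < csize k)%N ->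
  exists2 s : {perm 'I_(n - c)}, admissible C s /\ fixcount s = dI C c &
    exists i, h (row i) = k /\ col (s i) = row i.

Let irr a : chain_lt C a a = false.
Proof. by rewrite chain_ltE ltnn. Qed.

(** The three weights measure the in-degree of [a], the out-degree of [b] and the degree in the
    variable x_{a,b}. *)
Definition win (a : 'I_n) : 'I_#|{: V}| -> nat := edge_weight (fun x _ => x == a).
Definition wout (b : 'I_n) : 'I_#|{: V}| -> nat := edge_weight (fun _ y => y == b).
Definition wedge (a b : 'I_n) : 'I_#|{: V}| -> nat :=
  edge_weight (fun x y => (x == a) && (y == b)).

Local Notation m := (m_lI F C c).

Lemma win_le1 a : (wdeg (win a) m <= 1)%N.
Proof.
apply: wdeg_le => _ /(msupp_m_lI irr)[s As ->]; rewrite wt_perm_mon //.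
exact/sum_eq_inj_le1/minor_row_inj.
Qed.

Lemma wout_le1 b : (wdeg (wout b) m <= 1)%N.
Proof.
apply: wdeg_le => _ /(msupp_m_lI irr)[s As ->]; rewrite wt_perm_mon //.
exact/(@sum_eq_inj_le1 _ _ (col \o s))/(inj_comp (@minor_col_inj _ _) perm_inj).
Qed.

(** A vertex of a middle chain is both a row and a column. Its row is sent to the diagonal exactly
    when its column is reached from the diagonal, so both weights are 0 or both are 1. *)
Lemma win_wout a mm : (0 < h a < l.-1)%N -> mm \in msupp m -> wt (win a) mm = wt (wout a) mm.
Proof.
rewrite rowE colE => /andP[/minor_row_surj[i Ei] /minor_col_surj[j Ej]].
move=> /(msupp_m_lI irr)[s As ->]; rewrite !wt_perm_mon //.
rewrite -{1}Ei sum_eq_inj; last exact: minor_row_inj.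
have {1}-> : a = (col \o s) (s^-1%g j) by rewrite /= permKV.
rewrite (@sum_eq_inj _ _ (col \o s)); last exact: inj_comp (@minor_col_inj _ _) perm_inj.
rewrite permKV Ej Ei; congr (nat_of_bool (~~ _)).
rewrite -{1}Ej (inj_eq (@minor_col_inj _ _)) -{1}Ei (inj_eq (@minor_row_inj _ _)).
by rewrite -[RHS](inj_eq (@perm_inj _ s)) permKV.
Qed.

Lemma occurs a b : (h b < h a)%N -> (forall k, (h b < k < h a)%N -> (csize k < c)%N) ->
  (0 < wdeg (wedge a b) m)%N.
Proof.
move=> lt_ba small; have [s [As fs] [i [Ei Es]]] := edge_occurs lt_ba small.
have ms := perm_mon_msupp F irr As fs; apply: leq_trans (wt_le_wdeg (wedge a b) ms).
rewrite wt_perm_mon // (bigD1 i) /=; first by rewrite Ei Es !eqxx.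
by rewrite Ei Es; apply: contraTneq lt_ba => ->; rewrite ltnn.
Qed.

Lemma wedge_win (p : {mpoly F[#|{: V}|]}) a b : (wdeg (wedge a b) p <= wdeg (win a) p)%N.
Proof.
by apply: wdeg_mono => k; rewrite /wedge /win /edge_weight; case: (_ == a); case: (_ == b).
Qed.

Lemma wedge_wout (p : {mpoly F[#|{: V}|]}) a b : (wdeg (wedge a b) p <= wdeg (wout b) p)%N.
Proof.
by apply: wdeg_mono => k; rewrite /wedge /wout /edge_weight; case: (_ == a); case: (_ == b).
Qed.

(** * Distribution of rows and columns between two factors *)

Section Factor.

Variables g q : {mpoly F[#|{: V}|]}.
Hypothesis mE : m = g * q.
Hypothesis m0 : g * q != 0.

(** The factor containing x_{a,b} has positive degree in row [a] and in column [b]; both degrees are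
    at most 1 in the product, so the other factor has neither. *)
Lemma edge_side a b : (h b < h a)%N -> (forall k, (h b < k < h a)%N -> (csize k < c)%N) ->
  (0 < wdeg (win a) g)%N = (0 < wdeg (wout b) g)%N.
Proof.
move=> lt_ba small; have := occurs lt_ba small.
have := win_le1 a; have := wout_le1 b.
have := wedge_win g a b; have := wedge_win q a b.
have := wedge_wout g a b; have := wedge_wout q a b.
rewrite mE !wdegM //; lia.
Qed.

(** A monomial avoiding [a] has in- and out-degree 0 there, so [wdeg_factor] applies with the two
    weights in either order: one degree of [g] vanishes iff the other does. *)
Lemma vertex_side k : (0 < k < l.-1)%N -> (c < csize k)%N ->
  exists2 a, h a = k & (0 < wdeg (win a) g)%N = (0 < wdeg (wout a) g)%N.
Proof.
move=> k_mid big; have [s [As fs] [i [Ei Es]]] := vertex_avoided big.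
exists (row i) => //; set a := row i.
have bal mm : mm \in msupp (g * q) -> wt (win a) mm = wt (wout a) mm.
  by rewrite -mE; apply: win_wout; rewrite Ei.
have ms : perm_mon F C s \in msupp (g * q) by rewrite -mE perm_mon_msupp.
have w0 : wt (win a) (perm_mon F C s) = 0%N.
  rewrite wt_perm_mon // sum_eq_inj; last exact: minor_row_inj.
  by rewrite Es eqxx.
have := wdeg_factor bal ms w0.
have := wdeg_factor (fun mm pm => esym (bal mm pm)) ms (etrans (esym (bal _ ms)) w0).
by move: (wdeg (win a) g) (wdeg (wout a) g) => x y H1 H2; apply/idP/idP; lia.
Qed.

(** The search ends because the last chain has size [c]; the chains skipped are small, as
    [edge_side] requires. *)
Lemma next_big k : (k < l.-1)%N -> exists2 k', (k < k' < l)%N & (c <= csize k')%N /\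
  forall j, (k < j < k')%N -> (csize j < c)%N.
Proof.
move=> lt_kl; have ex : exists k', (k < k')%N && (c <= csize k')%N.
  by exists l.-1; rewrite lt_kl csize_last leqnn.
case: (ex_minnP ex) => k' /andP[lt_kk' big] min; exists k'.
  rewrite lt_kk' /=; have := min l.-1; rewrite lt_kl csize_last leqnn => /(_ isT); lia.
split=> // j /andP[lt_kj lt_jk']; rewrite ltnNge.
by apply: contraL lt_jk' => le; rewrite -leqNgt min ?lt_kj.
Qed.

Lemma prev_big k : (0 < k)%N -> exists2 k', (k' < k)%N & (c <= csize k')%N /\
  forall j, (k' < j < k)%N -> (csize j < c)%N.
Proof.
move=> k_gt0; have ex : exists k', (k' < k)%N && (c <= csize k')%N.
  by exists 0%N; rewrite k_gt0 csize_first leqnn.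
have bnd k' : (k' < k)%N && (c <= csize k')%N -> (k' <= k)%N by case/andP=> /ltnW.
case: (ex_maxnP ex bnd) => k' /andP[lt_kk' big] max; exists k' => //.
split=> // j /andP[lt_kj lt_jk']; rewrite ltnNge.
by apply: contraL lt_kj => le; rewrite -leqNgt max ?lt_jk'.
Qed.

(** Both columns are joined by [edge_side] to one row [v] of the next chain of size at least [c]. *)
Lemma out_side a b : h a = h b -> (h a < l.-1)%N ->
  (0 < wdeg (wout a) g)%N = (0 < wdeg (wout b) g)%N.
Proof.
move=> Eab /next_big[k' /andP[lt_k lt_l] [_ small]].
have /card_gt0P[v] := csize_gt0 lt_l; rewrite inE => /eqP Ev.
by rewrite -!(@edge_side v) // Ev -?Eab.
Qed.

Lemma in_side a b : (0 < h a)%N -> (0 < h b)%N ->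
  (0 < wdeg (win a) g)%N = (0 < wdeg (win b) g)%N.
Proof.
have /card_gt0P[z] := csize_gt0 (ltnW l_gt1); rewrite inE => /eqP Ez.
(* Strong induction on the chain index, with a column [z] of the first chain as reference. Columns
   are followed only in chains of size at least [c], the ones reached by [prev_big]. *)
suff {a b} key k : (k < l)%N ->
    (forall v, h v = k -> (0 < k)%N -> (0 < wdeg (win v) g)%N = (0 < wdeg (wout z) g)%N) /\
    ((c <= csize k)%N -> (k < l.-1)%N -> forall v, h v = k ->
      (0 < wdeg (wout v) g)%N = (0 < wdeg (wout z) g)%N).
  move=> a0 b0; have [-> //] := key _ (h_lt a); by have [-> //] := key _ (h_lt b).
elim/ltn_ind: k => k IH lt_kl.
have ins v : h v = k -> (0 < k)%N -> (0 < wdeg (win v) g)%N = (0 < wdeg (wout z) g)%N.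
  move=> Ev k0; have [k' lt_k [big small]] := prev_big k0.
  have /card_gt0P[u] := csize_gt0 (ltn_trans lt_k lt_kl); rewrite inE => /eqP Eu.
  rewrite (@edge_side v u) ?Ev ?Eu //.
  have [_ ->] // := IH k' lt_k (ltn_trans lt_k lt_kl); lia.
split=> // big lt_kl1 v Ev; have [k0|k0] := posnP k.
  by apply: out_side; rewrite ?Ev ?Ez ?k0 // -k0.
have k_mid : (0 < k < l.-1)%N by rewrite k0.
(* No middle chain has size [c], so this one is strictly larger and some vertex carries the side
   from its row to its column. *)
have [|a Ea side] := vertex_side k_mid.
  by rewrite ltn_neqAle big andbT eq_sym; apply/eqP/csize_mid.
by rewrite (@out_side v a) ?Ev ?Ea // -side ins.
Qed.

End Factor.

Lemma win_gt0 a : (0 < h a)%N -> (0 < wdeg (win a) m)%N.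
Proof.
move=> /prev_big[k lt_k [big small]].
have /card_gt0P[b] := csize_gt0 (ltn_trans lt_k (h_lt a)); rewrite inE => /eqP Eb.
apply: leq_trans (@occurs a b _ _) _; rewrite ?Eb //.
exact: wedge_win.
Qed.

Lemma win_eq0_unit (p : {mpoly F[#|{: V}|]}) : p != 0 ->
  (forall a, (0 < h a)%N -> wdeg (win a) p = 0%N) -> p \is a GRing.unit.
Proof.
move=> p0 z; apply: mpoly_const_unit => // mm pm; apply/mnmP => k; rewrite mnm0E.
set a := (val (enum_val k : V)).1.
have ha : (0 < h a)%N.
  by have := valP (enum_val k : V); rewrite mem_nilradical chain_ltE; apply: leq_ltn_trans.
apply/eqP; rewrite -leqn0 -(z a ha); apply: leq_trans (wt_le_wdeg (win a) pm).
by rewrite /wt (bigD1 k) //= /win /edge_weight eqxx mul1n leq_addr.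
Qed.

Lemma m_lI_irreducible : irreducible m.
Proof.
have /card_gt0P[z] := csize_gt0 (etrans (congr1 (leq^~ l) (prednK (ltnW l_gt1))) (leqnn l)).
rewrite inE => /eqP Ez; have z0 : (0 < h z)%N by rewrite Ez -ltnS prednK // ltnW.
have mz := win_gt0 z0.
have mn0 : m != 0.
  by apply: contraTneq mz => ->; rewrite /wdeg /wscale raddf0 size_poly0.
split=> //.
  apply: contraL mz => /unitrP[q [mq _]]; rewrite -leqNgt.
  have -> : 0%N = wdeg (win z) (q * m) by rewrite mq wdeg1.
  by rewrite wdegM ?mq ?oner_eq0 // leq_addl.
move=> g q mE; have gq0 : g * q != 0 by rewrite -mE.
have deg a : (0 < h a)%N -> (wdeg (win a) g + wdeg (win a) q = 1)%N.
  move=> a0; rewrite -wdegM // -mE; apply/eqP; rewrite eqn_leq win_le1; exact: win_gt0.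
have [gn0 qn0] : g != 0 /\ q != 0 by apply/andP; rewrite -negb_or -mulf_eq0.
have side := in_side mE gq0 _ z0.
(* A factor that misses row [z] misses every row, hence every variable, and is constant. *)
have [gz|gz] := posnP (wdeg (win z) g); [left|right]; apply: win_eq0_unit => // a a0.
  by have := side a a0; rewrite gz; lia.
by have := side a a0; have := deg a a0; rewrite gz; lia.
Qed.

End Connectivity.

(** * Path systems from labellings *)

Definition nat_swap (x y k : nat) : nat := if k == x then y else if k == y then x else k.

Lemma nat_swap_inj x y : injective (nat_swap x y).
Proof.
move=> j k; rewrite /nat_swap.
by case: (j =P x); case: (j =P y); case: (k =P x); case: (k =P y); lia.
Qed.

Lemma count_geq_iota c m : count (leq c) (iota 0 m) = (m - c)%N.
Proof.
elim: m => [|m IH]; first by rewrite sub0n.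
by rewrite -addn1 iotaD count_cat IH /= add0n; case: leqP; lia.
Qed.

Section Labels.

Variables (n c l d : nat) (h : 'I_n -> nat).

Local Notation row := (@minor_row n c).
Local Notation col := (@minor_col n c).
Local Notation chain k := [set v | h v == k].
Local Notation csize k := (#|chain k|).

Hypothesis rowE : forall a, (0 < h a)%N = (c <= a)%N.
Hypothesis colE : forall a, (h a < l.-1)%N = (a < n - c)%N.
Hypothesis c_gt0 : (0 < c)%N.
Hypothesis csize_first : csize 0%N = c.
Hypothesis csize_last : csize l.-1 = c.
Hypothesis h_lt : forall v, (h v < l)%N.
Hypothesis dE : d = (\sum_(k < l) (csize k - c))%N.

Lemma row_surj a : (0 < h a)%N -> exists i, row i = a.
Proof. by rewrite rowE => /minor_row_surj. Qed.

(** * From a labelling of the vertices to a permutation *)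

Section Routing.

Variable lam : 'I_n -> nat.
Hypothesis lam_inj : forall u v, h u = h v -> lam u = lam v -> u = v.
Hypothesis lam_lt : forall v, (lam v < maxn c (csize (h v)))%N.

(** Counting: in a chain of size at least [c], the labels are distinct and bounded by the size, so
    each is taken exactly once. *)
Lemma labels_perm k : (c <= csize k)%N ->
  perm_eq [seq lam v | v <- enum (chain k)] (iota 0 (csize k)).
Proof.
move=> le_c.
have un : uniq [seq lam v | v <- enum (chain k)].
  rewrite map_inj_in_uniq ?enum_uniq // => u v; rewrite !mem_enum !inE => /eqP hu /eqP hv.
  by apply: lam_inj; rewrite hu hv.
have sub : {subset [seq lam v | v <- enum (chain k)] <= iota 0 (csize k)}.
  move=> x /mapP[v]; rewrite mem_enum inE => /eqP hv ->.
  by rewrite mem_iota; have := lam_lt v; rewrite hv (maxn_idPr le_c).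
have [|_ eqm] := uniq_min_size un sub; first by rewrite size_map size_iota -cardE.
by apply: uniq_perm; rewrite ?iota_uniq.
Qed.

Lemma label_attained k x : (c <= csize k)%N -> (x < csize k)%N -> exists2 v, h v = k & lam v = x.
Proof.
move=> /labels_perm/perm_mem/(_ x); rewrite mem_iota /= => E lt_x.
move: E; rewrite add0n lt_x => /mapP[v]; rewrite mem_enum inE => /eqP hv ->.
by exists v.
Qed.

Lemma uncovered_card k : #|[set v in chain k | (c <= lam v)%N]| = (csize k - c)%N.
Proof.
have [le_c|lt_c] := leqP c (csize k); last first.
  rewrite (eqP (ltnW lt_c : (_ - _ == 0)%N)); apply: eq_card0 => v; rewrite !inE.
  by case: eqP => //= hv; have := lam_lt v; rewrite hv (maxn_idPl (ltnW lt_c)) ltnNge => /negPf.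
rewrite -(count_geq_iota c (csize k)) -(seq.permP (labels_perm le_c)) count_map.
rewrite -size_filter cardE.
apply/perm_size/uniq_perm; [exact: enum_uniq|by rewrite filter_uniq // enum_uniq|].
by move=> v; rewrite mem_enum mem_filter mem_enum !inE andbC.
Qed.

Lemma uncovered_total : #|[set v | (c <= lam v)%N]| = d.
Proof.
rewrite dE -sum1_card (partition_big (fun v => Ordinal (h_lt v)) xpredT) //=.
apply: eq_bigr => k _; rewrite -uncovered_card -sum1_card; apply: eq_bigl => v.
by rewrite !inE andbC -val_eqE.
Qed.

(* The vertices sharing a label below [c] form a path, in which [u] precedes [v];
   a vertex with a larger label lies on no path and is a diagonal row. *)
Definition routes (v u : 'I_n) :=
  if (c <= lam v)%N then u = v else
  [/\ lam u = lam v, (h u < h v)%N &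
      forall u', lam u' = lam v -> (h u' < h v)%N -> (h u' <= h u)%N].

(** Two successors of [u] share its label. Were they in different chains, the earlier one would lie
    strictly between [u] and the later one, against maximality. *)
Lemma routes_inj v v' u : routes v u -> routes v' u -> v = v'.
Proof.
rewrite /routes; case: ifP => [le_v ->|lt_v [Eu lt_uv maxv]]; case: ifP => [le_v'|lt_v'].
- by [].
- by case=> E; rewrite -E le_v in lt_v'.
- by move=> E; rewrite -Eu E le_v' in lt_v.
case=> Eu' lt_uv' maxv'; have E : lam v = lam v' by rewrite -Eu.
apply: lam_inj => //; apply/eqP; rewrite eqn_leq.
apply/andP; split; rewrite leqNgt; apply/negP => lt.
  by have := maxv v' (esym E) lt; rewrite leqNgt lt_uv'.
by have := maxv' v E lt; rewrite leqNgt lt_uv.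
Qed.

Lemma routes_exists v : (0 < h v)%N -> exists2 u, (h u < l.-1)%N & routes v u.
Proof.
rewrite /routes => v0; have le_hv : (h v <= l.-1)%N by have := h_lt v; case: l.
case: (leqP c (lam v)) => [le_c|lt_c].
  exists v => //; rewrite ltn_neqAle le_hv andbT; apply: contraL le_c => /eqP hv.
  by rewrite -ltnNge; have := lam_lt v; rewrite hv csize_last maxnn.
(* The first chain has size [c] and so carries every label below [c]: a path can always be continued
   backwards. *)
have [||u0 hu0 lu0] := @label_attained 0%N (lam v); rewrite ?csize_first //.
pose P u := (lam u == lam v) && (h u < h v)%N.
have P0 : P u0 by rewrite /P lu0 eqxx hu0.
case: (arg_maxnP (P := P) h P0) => u /andP[/eqP Eu lt_u] max.
exists u; first exact: leq_trans le_hv.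
by split=> // u' Eu' lt_u'; apply: max; rewrite /P Eu' eqxx.
Qed.

(** Predecessors avoid the last chain, so they are columns, and [routes_inj] makes the choice
    injective. The diagonal rows are the vertices with label at least [c], counted by
    [uncovered_total]. *)
Lemma routing_perm : exists2 s : {perm 'I_(n - c)},
  #|[pred i | col (s i) == row i]| = d & forall i, routes (row i) (col (s i)).
Proof.
have row_gt0 i : (0 < h (row i))%N by rewrite rowE leq_addr.
have /fin_all_exists[f fP] i : exists j, routes (row i) (col j).
  have [u lt_u ru] := routes_exists (row_gt0 i).
  by move: lt_u; rewrite colE => lt_u; exists (Ordinal lt_u); congr routes: ru; apply: val_inj.
have f_inj : injective f.
  by move=> i j E; apply/(@minor_row_inj n c)/(routes_inj (fP i)); rewrite E.
exists (perm f_inj) => [|i]; last by rewrite permE.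
rewrite -uncovered_total -(card_imset _ (@minor_row_inj n c)); apply: eq_card => v.
rewrite !inE; apply/imsetP/idP => [[i fi ->]|le_v].
  move: fi; rewrite inE permE => /eqP E; have := fP i; rewrite /routes; case: ifP => // _ [_].
  by rewrite E ltnn.
have v0 : (0 < h v)%N.
  rewrite lt0n; apply: contraL le_v => /eqP hv; have := lam_lt v.
  by rewrite hv csize_first maxnn -ltnNge.
have [i Ei] := row_surj v0; exists i => //; rewrite inE permE Ei.
by have := fP i; rewrite Ei /routes le_v => ->.
Qed.

End Routing.

(** * Two labellings: ranks, and ranks with one transposition per chain *)

Definition rank_in_chain (v : 'I_n) : nat := #|[set u | (h u == h v) && (u < v)%N]|.

Lemma rank_inj u v : h u = h v -> rank_in_chain u = rank_in_chain v -> u = v.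
Proof.
suff lt_rank x y : h x = h y -> (x < y)%N -> (rank_in_chain x < rank_in_chain y)%N.
  move=> huv E; apply: val_inj; case: (ltngtP u v) => // lt.
    by have := lt_rank _ _ huv lt; rewrite E ltnn.
  by have := lt_rank _ _ (esym huv) lt; rewrite E ltnn.
move=> hxy lt_xy; apply/proper_card/properP; split.
  by apply/subsetP => w; rewrite !inE hxy => /andP[-> /ltn_trans->].
by exists x; rewrite !inE ?hxy ?eqxx ?ltnn.
Qed.

Lemma rank_lt v : (rank_in_chain v < csize (h v))%N.
Proof.
apply/proper_card/properP; split; first by apply/subsetP => w; rewrite !inE => /andP[].
by exists v; rewrite !inE ?eqxx ?ltnn.
Qed.

Lemma avoiding_perm k : (c < csize k)%N ->
  exists2 s : {perm 'I_(n - c)},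
    #|[pred i | col (s i) == row i]| = d /\
    (forall i, col (s i) = row i \/ (h (col (s i)) < h (row i))%N) &
    exists i, h (row i) = k /\ col (s i) = row i.
Proof.
move=> big; have lt_max v : (rank_in_chain v < maxn c (csize (h v)))%N.
  by rewrite leq_max rank_lt orbT.
have [s fs rs] := routing_perm rank_inj lt_max.
exists s; first split=> // i.
  by have := rs i; rewrite /routes; case: ifP => _; [left|case; right].
(* More than [c] vertices means that the label [c] itself occurs, and its vertex goes to the
   diagonal. *)
have [a ha ra] := label_attained rank_inj lt_max (ltnW big) big.
have a0 : (0 < h a)%N.
  by rewrite ha lt0n; apply: contraTneq big => ->; rewrite csize_first ltnn.
have [i Ei] := row_surj a0; exists i; rewrite Ei; split=> //.
by have := rs i; rewrite /routes Ei ra leqnn.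
Qed.

Lemma edge_perm a b : (h b < h a)%N ->
  (forall k, (h b < k < h a)%N -> (csize k < c)%N) ->
  exists2 s : {perm 'I_(n - c)},
    #|[pred i | col (s i) == row i]| = d /\
    (forall i, col (s i) = row i \/ (h (col (s i)) < h (row i))%N) &
    exists i, row i = a /\ col (s i) = b.
Proof.
(* The label [c.-1] is moved to [a] and [b] in their chains; the chains in between
   are too small to use it, so [b] directly precedes [a] on the path [c.-1]. *)
move=> lt_ba small.
(* The default [c.-1] makes the transposition trivial on all other chains. *)
pose x k := if k == h a then rank_in_chain a else if k == h b then rank_in_chain b else c.-1.
pose lam v := nat_swap (x (h v)) c.-1 (rank_in_chain v).
have lam_inj u v : h u = h v -> lam u = lam v -> u = v.
  by move=> huv; rewrite /lam huv => /nat_swap_inj; apply: rank_inj.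
have lam_lt v : (lam v < maxn c (csize (h v)))%N.
  have lt_c : (c.-1 < maxn c (csize (h v)))%N by rewrite leq_max prednK ?leqnn.
  have lt_r w : h w = h v -> (rank_in_chain w < maxn c (csize (h v)))%N.
    by move=> <-; rewrite leq_max rank_lt orbT.
  rewrite /lam /nat_swap; case: eqP => // _; case: eqP => [_|_]; last exact: lt_r.
  by rewrite /x; case: eqP => [/esym/lt_r//|_]; case: eqP => [/esym/lt_r|].
have lam_a : lam a = c.-1 by rewrite /lam /x /nat_swap !eqxx.
have lam_b : lam b = c.-1 by rewrite /lam /x /nat_swap (ltn_eqF lt_ba) !eqxx.
have [s fs rs] := routing_perm lam_inj lam_lt.
exists s; first split=> // i.
  by have := rs i; rewrite /routes; case: ifP => _; [left|case; right].
have [i Ei] := row_surj (leq_ltn_trans (leq0n _) lt_ba); exists i; split=> //.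
have := rs i; rewrite /routes Ei lam_a leqNgt prednK // leqnn /= => -[lam_u lt_u max].
have le_u := max b lam_b lt_ba; apply: lam_inj; last by rewrite lam_u lam_b.
apply/eqP; rewrite eqn_leq le_u andbT leqNgt; apply/negP => lt_bu.
have := small (h (col (s i))); rewrite lt_bu lt_u => /(_ isT) lt_c.
(* In a chain strictly in between, the label is the rank, which is below a size less than [c] and so
   cannot equal [c.-1]. *)
have := rank_lt (col (s i)); move: lam_u; rewrite /lam /x (ltn_eqF lt_u) (gtn_eqF lt_bu).
by rewrite /nat_swap; case: (rank_in_chain _ =P _); lia.
Qed.

End Labels.

(** * The chain form *)

Lemma card_ord_lt n k : (k <= n)%N -> #|[set u : 'I_n | (u < k)%N]| = k.
Proof.
move=> le_kn; have inj : injective (widen_ord le_kn).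
  by move=> u v /(congr1 val) E; apply: val_inj.
rewrite -[RHS]card_ord -(card_imset _ inj).
apply: eq_card => u; rewrite inE; apply/idP/imsetP => [lt_u|[v _ ->]]; last exact: (ltn_ord v).
by exists (Ordinal lt_u) => //; apply: val_inj.
Qed.

Definition chain_index (n : nat) (C : seq {set 'I_n}) (v : 'I_n) : nat :=
  find (fun A : {set 'I_n} => v \in A) C.

Section ChainForm.

Variables (n : nat) (I : {set 'I_n.-1}) (C : seq {set 'I_n}) (c : nat).
Hypothesis form : chain_form I C.

Local Notation h := (chain_index C).

Lemma chain_index_lt v : (h v < size C)%N.
Proof.
case: form => _ /and3P[/eqP cov _ _] _ _; rewrite -has_find.
have : v \in cover [set:: C] by rewrite cov inE.
by case/bigcupP=> A; rewrite inE => AC vA; apply/hasP; exists A.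
Qed.

Lemma mem_chain_index v : v \in nth set0 C (h v).
Proof.
by apply: (@nth_find _ set0 (fun A : {set 'I_n} => v \in A) C); rewrite has_find chain_index_lt.
Qed.

Lemma chain_indexP v i : (i < size C)%N -> v \in nth set0 C i -> h v = i.
Proof.
case: form => _ _ mono _ lt_i vi; have vh := mem_chain_index v; have lt_h := chain_index_lt v.
case: (ltngtP (h v) i) => // lt.
  by have := mono _ _ v v _ vh vi; rewrite lt lt_i ltnn => /(_ isT).
by have := mono _ _ v v _ vi vh; rewrite lt lt_h ltnn => /(_ isT).
Qed.

Lemma chain_setE k : (k < size C)%N -> [set v | h v == k] = nth set0 C k.
Proof.
move=> lt_k; apply/setP => v; rewrite inE; apply/eqP/idP => [<-|]; first exact: mem_chain_index.
exact: chain_indexP.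
Qed.

Lemma chain_lt_index a b : chain_lt C a b = (h a < h b)%N.
Proof.
apply/existsP/idP => [[i /existsP[j /and3P[lt_ij ai bj]]]|lt_ab].
  by rewrite (chain_indexP _ ai) // (chain_indexP _ bj).
exists (Ordinal (chain_index_lt a)); apply/existsP; exists (Ordinal (chain_index_lt b)).
by rewrite /= lt_ab !mem_chain_index.
Qed.

Lemma chain_size_index k : (k < size C)%N -> #|[set v | h v == k]| = chain_size C k.
Proof. by move=> lt_k; rewrite chain_setE. Qed.

Lemma chain_size_gt0 k : (k < size C)%N -> (0 < chain_size C k)%N.
Proof.
move=> lt_k; case: form => _ /and3P[_ _ n0] _ _; rewrite card_gt0.
by apply: contraNneq n0 => <-; rewrite inE mem_nth.
Qed.

Lemma index_lt_val a b : (h a < h b)%N -> (a < b)%N.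
Proof.
case: form => _ _ mono _ lt_ab; apply: (mono (h a) (h b)); rewrite ?mem_chain_index //.
by rewrite lt_ab chain_index_lt.
Qed.

(** Chains are ordered, so the first is an initial segment: it lies below any [a] outside it, and
    contains everything up to any [a] inside it. Comparing cardinals gives both directions. *)
Lemma first_chain a : (0 < size C)%N -> chain_size C 0 = c -> (0 < h a)%N = (c <= a)%N.
Proof.
move=> l0; rewrite -chain_size_index // => <-; apply/idP/idP => [ha|].
  rewrite -[X in (_ <= X)%N](card_ord_lt (ltnW (ltn_ord a))); apply/subset_leq_card/subsetP => u.
  by rewrite !inE => /eqP hu; apply: index_lt_val; rewrite hu.
apply: contraLR; rewrite -leqNgt leqn0 => /eqP ha; rewrite -ltnNge.
rewrite -[X in (X <= _)%N](card_ord_lt (ltn_ord a)); apply/subset_leq_card/subsetP => u.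
rewrite !inE ltnS; apply: contraLR; rewrite -lt0n -ltnNge -[in X in X -> _]ha.
exact: index_lt_val.
Qed.

Lemma last_chain a : chain_size C (size C).-1 = c ->
  (h a < (size C).-1)%N = (a < n - c)%N.
Proof.
have l0 : (0 < size C)%N by apply: leq_ltn_trans (chain_index_lt a).
have le_l v : (h v <= (size C).-1)%N by rewrite -ltnS prednK // chain_index_lt.
rewrite -chain_size_index ?prednK // => <-.
have cardC k : (k <= n)%N -> #|[set u : 'I_n | (k <= u)%N]| = (n - k)%N.
  move=> le_k; rewrite cardsCs card_ord -[in RHS](card_ord_lt le_k); congr (_ - _)%N.
  by apply: eq_card => u; rewrite !inE -ltnNge.
have lt_n := ltn_ord a.
apply/idP/idP => [ha|].
  have : (#|[set v | h v == (size C).-1]| <= #|[set u : 'I_n | (a.+1 <= u)%N]|)%N.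
    apply/subset_leq_card/subsetP => u; rewrite !inE => /eqP hu.
    by apply: index_lt_val; rewrite hu.
  by rewrite cardC //; lia.
apply: contraLR; rewrite -leqNgt => ha; rewrite -leqNgt leq_subLR -leq_subLR.
rewrite leq_subCl -cardC ?(ltnW lt_n) //; apply/subset_leq_card/subsetP => u.
rewrite !inE => le_au; rewrite eqn_leq le_l /= (leq_trans ha) //.
by rewrite leqNgt; apply: contraL le_au => /index_lt_val; rewrite -ltnNge.
Qed.

End ChainForm.

(** * Irreducibility of the lowest coefficient *)

Theorem proposition3p15 (R : realType) (n : nat) (I : {set 'I_n.-1})
    (C : seq {set 'I_n}) (c : nat) :
  chain_form I C ->
  (2 <= size C)%N ->
  chain_size C 0 = c ->
  chain_size C (size C).-1 = c ->
  (forall j : nat, (0 < j < (size C).-1)%N -> chain_size C j <> c) ->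
  irreducible (m_lI R[i] C c).
Proof.
move=> form l_gt1 first last mid; pose h := chain_index C.
have l_gt0 : (0 < size C)%N by exact: ltnW.
have lt_last : ((size C).-1 < size C)%N by rewrite prednK.
have csizeE k : (k < size C)%N -> #|[set v | h v == k]| = chain_size C k.
  exact: chain_size_index form k.
(* Blocks of a partition are nonempty; positivity of [c] makes [c.-1] a genuine label in
   [edge_perm]. *)
have c_gt0 : (0 < c)%N by rewrite -first (chain_size_gt0 form).
have h_lt := chain_index_lt form; have ltE := chain_lt_index form.
have rowE a : (0 < h a)%N = (c <= a)%N by exact: first_chain form a l_gt0 first.
have colE a : (h a < (size C).-1)%N = (a < n - c)%N by exact: last_chain form a last.
have csize0 : #|[set v | h v == 0%N]| = c by rewrite csizeE.
have csizel : #|[set v | h v == (size C).-1]| = c by rewrite csizeE.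
have dE : dI C c = (\sum_(k < size C) (#|[set v | h v == k]| - c))%N.
  by apply: eq_bigr => k _; rewrite csizeE.
have adm (s : {perm 'I_(n - c)}) : (forall i, minor_col (s i) = minor_row i \/
    (h (minor_col (s i)) < h (minor_row i))%N) -> admissible C s.
  by move=> sP; apply/forallP => i; rewrite ltE; case: (sP i) => [->|->]; rewrite ?eqxx ?orbT.
apply: (@m_lI_irreducible _ _ _ _ (size C) h) => //.
- by move=> k lt_k; rewrite csizeE ?(chain_size_gt0 form).
- move=> k k_mid; rewrite csizeE; first exact: mid.
  by case/andP: k_mid => _ /leq_trans->; rewrite ?leq_pred.
- move=> a b lt_ba small.
  have [s [fs /adm As] ex] := edge_perm rowE colE c_gt0 csize0 csizel h_lt dE lt_ba small.
  by exists s.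
- move=> k big; have [s [fs /adm As] ex] := avoiding_perm rowE colE csize0 csizel h_lt dE big.
  by exists s.
Qed.
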